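(* Let $n \in \mathbb{Z}_{\geqslant 2}$. Then $P(n)$ is an infinite set of prime numbers.
   Context: For an integer $n \geqslant 2$, define a sequence of integers $(a_k(n))_{k \geqslant 0}$ recursively by $a_0(n) = n$ and $a_{k+1}(n) = a_k(n)^2 - 1$. Let $P(n)$ be the set of all prime numbers $p$ such that $p$ divides $a_k(n)$ for some $k \geqslant 0$. *)

(* Defs.v *)
From mathcomp Require Import all_boot all_order all_algebra.
From mathcomp Require Import classical_sets cardinality.

Set Implicit Arguments.
Unset Strict Implicit.
Unset Printing Implicit Defensive.

Import GRing.Theory.
Local Open Scope ring_scope.

Fixpoint a (k : nat) (n : int) : int :=
  if k is k'.+1 then a k' n ^+ 2 - 1 else n.

(* Primes are natural numbers; divisibility is taken in the integers. *)
Definition P (n : int) : set nat :=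
  [set p : nat | prime p /\ exists k : nat, (p%:Z %| a k n)%Z]%classic.

(* Main.v *)
Require Import Defs.
From mathcomp Require Import all_boot all_order all_algebra.
From mathcomp Require Import classical_sets cardinality.
From mathcomp Require Import zify ring.

(** The point 0 is periodic of period 2 under x |-> x^2 - 1, since
    0 |-> -1 |-> 0.  Two steps of the recursion therefore have 0 as a fixed
    point: they send x to (x^2 - 1)^2 - 1 = x^2 (x^2 - 2).  So every prime
    divisor of a_k persists in a_(k+2), and a new one appears: a prime dividing
    both x and x^2 - 2 is 2, while for x >= 3 the number x^2 - 2 > 2 is not a
    power of 2, because x^2 - 2 is never divisible by 4 ([odd_dvd_sqr_sub2]).
    Hence the number of prime divisors of a_(2k+1) grows strictly with k
    ([size_primes_two_steps], [size_primes_a_odd]), and no finite set can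
    contain all of these primes.  Starting from a_1 instead
    of a_0 guarantees x >= 3, even when n = 2. *)

(** The odd part of m^2 - 2: if m is even then m^2 - 2 is twice an odd number. *)
Lemma odd_dvd_sqr_sub2 (m : nat) :
  2 < m -> exists u, [/\ odd u, 1 < u & u %| m ^ 2 - 2].
Proof.
move=> m_gt2; case: (boolP (odd m)) => m_odd.
  exists (m ^ 2 - 2); split=> //; last by nia.
  by rewrite oddB ?oddX ?m_odd //; nia.
have def_m : m = m./2.*2 by rewrite even_halfK.
(* With m = 2h, m^2 - 2 = 2 (2 h^2 - 1). *)
exists ((m./2 ^ 2).*2.-1); split.
- have -> : (m./2 ^ 2).*2.-1 = ((m./2 ^ 2).-1).*2.+1 by nia.
  by rewrite /= odd_double.
- by nia.
- by apply/dvdnP; exists 2; rewrite {1}def_m; nia.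
Qed.

Lemma new_prime_dvd_sqr_sub2 (m : nat) :
  2 < m -> exists p, [/\ prime p, p %| m ^ 2 - 2 & ~~ (p %| m)].
Proof.
move=> m_gt2; have [u [u_odd u_gt1 u_dvd]] := odd_dvd_sqr_sub2 m m_gt2.
have p_dvd : pdiv u %| m ^ 2 - 2 := dvdn_trans (pdiv_dvd u) u_dvd.
exists (pdiv u); split=> //; first exact: pdiv_prime.
apply/negP=> p_dvd_m.
have p_dvd2 : pdiv u %| 2.
  have -> : 2 = m ^ 2 - (m ^ 2 - 2) by nia.
  by apply: dvdn_sub p_dvd; apply: dvdn_mulr.
have /eqP p2 : pdiv u == 2 by rewrite -dvdn_prime2 ?pdiv_prime.
by have := pdiv_dvd u; rewrite p2 dvdn2 u_odd.
Qed.

Lemma size_primes_two_steps (m : nat) :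
  2 < m -> size (primes m) < size (primes (m ^ 2 * (m ^ 2 - 2))).
Proof.
move=> m_gt2; have [p [p_pr p_dvd p_ndvd]] := new_prime_dvd_sqr_sub2 m m_gt2.
have x_gt0 : 0 < m ^ 2 * (m ^ 2 - 2) by rewrite muln_gt0; apply/andP; split; nia.
apply: (@uniq_leq_size _ (p :: primes m)) => /= [|q].
  by rewrite primes_uniq mem_primes (negPf p_ndvd) !andbF.
rewrite inE => /predU1P[-> | ]; first by rewrite mem_primes p_pr x_gt0 dvdn_mull.
rewrite !mem_primes => /and3P[-> _ q_dvd].
by rewrite x_gt0 -mulnA dvdn_mulr.
Qed.

(** The value is carried as a natural number so that its list of prime
    divisors makes sense; the bound 2 < m is what lets the induction go on. *)
Lemma size_primes_a_odd (n : int) (k : nat) : (2 <= n)%R ->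
  exists m : nat, [/\ a k.*2.+1 n = Posz m, 2 < m & k <= size (primes m)].
Proof.
move=> n_ge2; elim: k => [|k [m [am m_gt2 k_le]]].
  case: n n_ge2 => // n n_ge2; exists (n ^ 2 - 1); split=> //; last by nia.
  by rewrite /=; nia.
exists (m ^ 2 * (m ^ 2 - 2)); split.
- have sqr_ge2 : 2 <= m ^ 2 by nia.
  rewrite doubleS; change (a k.*2.+3 n) with ((a k.*2.+1 n ^+ 2 - 1) ^+ 2 - 1)%R.
  by rewrite am PoszM -subzn // -[m ^ 2]/(m * m) PoszM; ring.
- by nia.
- exact: leq_ltn_trans k_le (size_primes_two_steps m m_gt2).
Qed.

Theorem proposition2p3 (n : int) (hn : (2 <= n)%R) : infinite_set (P n).
Proof.
move=> /finite_seqP[s Ps].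
have [m [am m_gt2 s_lt]] := size_primes_a_odd n (size s).+1 hn.
have : size (primes m) <= size s.
  apply: uniq_leq_size (primes_uniq m) _ => p.
  rewrite mem_primes => /and3P[p_pr _ p_dvd].
  suff : P n p by rewrite Ps.
  by split=> //; exists (size s).+1.*2.+1; rewrite am.
by rewrite leqNgt s_lt.
Qed.
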